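(* Let $e_t>0$, $r>0$, $0<\delta\le 2$, $e_I\ge 0$, $\bm{t}_0\in\mathbb{C}^Q$, $\bm{s}_0\in\mathbb{C}^{N_TL}$, and let $$\Psi_S=\left\{\bm{s}\in\mathbb{C}^{N_TL}:\ \|\bm{s}\|_2^2\le e_t,\ \|\bm{s}-\bm{s}_0\|_\infty\le\frac{\delta\sqrt{e_t}}{\sqrt{N_TL}},\ \bm{s}^{\rm H}\bm{R}_I\bm{s}\le e_I\right\},$$ assumed nonempty. Let $\bm{s}^{(l)}\in\Psi_S$ and let $\tilde z^S(\bm{s},\bm{s}^{(l)})=\min_{\|\bm{t}-\bm{t}_0\|_2\le r}\bm{t}^{\rm H}\bm{U}(\bm{s},\bm{s}^{(l)})\bm{t}$. Then the problem $$\mathcal{P}_r^{S,(l)}:\quad \max_{\bm{s}\in\Psi_S}\ \tilde z^S(\bm{s},\bm{s}^{(l)})$$ is equivalent to the problem $$\hat{\mathcal{P}}_r^{S,(l)}:\quad \max_{\bm{s},\lambda,\gamma}\ \gamma\quad\text{s.t.}\quad\begin{bmatrix}\bm{U}(\bm{s},\bm{s}^{(l)})+\lambda\mathbf{I}&\lambda\bm{t}_0\\ \lambda\bm{t}_0^{\rm H}&\lambda\bm{t}_0^{\rm H}\bm{t}_0-\lambda r^2-\gamma\end{bmatrix}\succeq 0,\quad \bm{s}\in\Psi_S,\quad\lambda\ge 0,$$ with auxiliary variables $\lambda,\gamma\in\mathbb{R}$, in the sense that optimal solutions of the two problems can be constructed from each other: $\bm{s}^*$ is optimal for $\mathcal{P}_r^{S,(l)}$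 if and only if there are $\lambda^*,\gamma^*\in\mathbb{R}$ such that $(\bm{s}^*,\lambda^*,\gamma^* )$ is optimal for $\hat{\mathcal{P}}_r^{S,(l)}$.
   Context: Let $N_T,N_R,L,Q\ge 1$ be integers, and let $\bm{a}\in\mathbb{C}^{N_T}$ and $\bm{b}\in\mathbb{C}^{N_R}$ be fixed vectors (the transmit and receive steering vectors). For $i=0,\dots,Q-1$ let $\bm{J}_i$ be the $(Q+L-1)\times L$ shift matrix with $\bm{J}_i(m,n)=1$ if $m-n=i$ and $0$ otherwise. For $\bm{s}\in\mathbb{C}^{N_TL}$ let $\bm{H}(\bm{s})=[\bm{A}_1\bm{s},\dots,\bm{A}_Q\bm{s}]$, where $\bm{A}_i=\bm{J}_{i-1}\otimes(\bm{b}\bm{a}^{\rm T})$; this is an $N_R(Q+L-1)\times Q$ matrix. $\bm{R}_c$ is a Hermitian positive definite matrix of size $N_R(Q+L-1)$ (the noise covariance). Define the Hermitian $Q\times Q$ matrix $$\bm{U}(\bm{s},\bm{s}^{(l)})=\bm{H}(\bm{s}^{(l)})^{\rm H}\bm{R}_c^{-1}\bm{H}(\bm{s})+\bm{H}(\bm{s})^{\rm H}\bm{R}_c^{-1}\bm{H}(\bm{s}^{(l)})-\bm{H}(\bm{s}^{(l)})^{\rm H}\bm{R}_c^{-1}\bm{H}(\bm{s}^{(l)}).$$ The spectral compatibility matrix is $\bm{R}_I=\sum_{k=1}^K\alpha_k\,\mathbf{I}_{N_T}\otimes\bm{R}_I^k$ with weights $\alpha_k\ge 0$, where $\bm{R}_I^k$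 is the $L\times L$ matrix with entries $\bm{R}_I^k(m,n)=f_2^k-f_1^k$ if $m=n$ and $\bm{R}_I^k(m,n)=\frac{e^{j2\pi f_2^k(m-n)}-e^{j2\pi f_1^k(m-n)}}{j2\pi(m-n)}$ if $m\ne n$, with $[f_1^k,f_2^k]$, $f_1^k<f_2^k$, normalized frequency intervals and $j=\sqrt{-1}$. Superscript ${\rm H}$ denotes conjugate transpose, $\|\cdot\|_\infty$ is the maximum modulus of the entries, and $\succeq 0$ means Hermitian positive semidefinite. The minimum defining $\tilde z^S$ is over $\bm{t}\in\mathbb{C}^Q$. *)

(* Defs.v *)
(* Complex vectors and matrices have entries in R[i], for any R : realType. *)
From HB Require Import structures.
From mathcomp Require Import all_boot all_order all_algebra.
From mathcomp Require Import all_classical all_reals all_analysis.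
From mathcomp Require Import complex ring lra.
From mathcomp Require mxtens.
Set Implicit Arguments.
Unset Strict Implicit.
Unset Printing Implicit Defensive.
Import Order.TTheory GRing.Theory Num.Theory numFieldNormedType.Exports.
Local Open Scope classical_set_scope.
Local Open Scope ring_scope.
Local Open Scope sesquilinear_scope.
Local Open Scope complex_scope.

Section Vectors.
Variable R : realType.
Implicit Types n : nat.

Definition l2norm n (x : 'cV[R[i]]_n) : R :=
  Num.sqrt (\sum_(i < n) ComplexField.Normc.normc (x i ord0) ^+ 2).

Definition linfnorm n (x : 'cV[R[i]]_n) : R :=
  \big[Num.max/0]_(i < n) ComplexField.Normc.normc (x i ord0).

(* For Hermitian A, x^H A x is real and [qform] is that number: qform_real. *)
Definition qform n (A : 'M[R[i]]_n) (x : 'cV[R[i]]_n) : R :=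
  complex.Re ((x ^t* *m A *m x) ord0 ord0).

(* On R[i], [u <= v] means that v - u is real and nonnegative. *)
Definition psdmx n (A : 'M[R[i]]_n) : Prop :=
  A \is hermsymmx /\
  forall x : 'cV[R[i]]_n, 0 <= (x ^t* *m A *m x) ord0 ord0.

Definition posdefmx n (A : 'M[R[i]]_n) : Prop :=
  A \is hermsymmx /\
  forall x : 'cV[R[i]]_n, x != 0 -> 0 < (x ^t* *m A *m x) ord0 ord0.

Lemma hermsymmx_congr m n (A : 'M[R[i]]_m) (X Y : 'M[R[i]]_(m, n)) :
  A \is hermsymmx -> (X ^t* *m A *m Y) ^t* = Y ^t* *m A *m X.
Proof.
move=> /is_hermitianmxP; rewrite expr0 scale1r => hA.
rewrite !trmx_mul !map_mxM /= -hA mulmxA; congr (_ *m _ *m _).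
by apply/matrixP => i j; rewrite !mxE; exact: conjCK.
Qed.

Lemma qform_real n (A : 'M[R[i]]_n) (x : 'cV[R[i]]_n) :
  A \is hermsymmx -> (x ^t* *m A *m x) ord0 ord0 = (qform A x)%:C.
Proof.
move=> hA; pose z := x ^t* *m A *m x.
have zH : z ^t* = z by exact: hermsymmx_congr.
have : (z ord0 ord0)^*%C = z ord0 ord0.
  by move/matrixP: zH => /(_ ord0 ord0); rewrite !mxE.
rewrite /qform -/z; case: (z ord0 ord0) => u v /= [] vE.
by congr Complex; lra.
Qed.

Lemma hermsymmx_inv n (A : 'M[R[i]]_n) :
  A \is hermsymmx -> invmx A \is hermsymmx.
Proof.
move=> /is_hermitianmxP; rewrite expr0 scale1r => hA.
by apply/is_hermitianmxP; rewrite expr0 scale1r trmx_inv map_invmx -hA.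
Qed.

End Vectors.

(* The least element of A, and 0 if A has none. *)
Definition setmin (R : realType) (A : set R) : R := xget 0 (A `&` lbound A).

Definition is_argmax (R : realType) (T : Type) (S : set T) (f : T -> R) (x : T)
    : Prop :=
  S x /\ forall y, S y -> f y <= f x.

Section Radar.
Variable R : realType.
Local Notation C := R[i].

Definition shiftmx (Q L i : nat) : 'M[C]_(Q + L - 1, L) :=
  \matrix_(m, n) ((m == n + i :> nat)%N)%:R.

Section Waveform.
Variables (NT NR L Q : nat) (a : 'cV[C]_NT) (b : 'cV[C]_NR).

(* Indices start at 0: steermx i is the matrix J_i \otimes (b a^T), i < Q. *)
Definition steermx (i : 'I_Q) : 'M[C]_((Q + L - 1) * NR, L * NT) :=
  mxtens.tensmx (shiftmx Q L i) (b *m a^T).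

Definition Hmx (s : 'cV[C]_(L * NT)) : 'M[C]_((Q + L - 1) * NR, Q) :=
  \matrix_(m, i) (steermx i *m s) m ord0.

Definition Umx (Rc : 'M[C]_((Q + L - 1) * NR)) (s sl : 'cV[C]_(L * NT))
    : 'M[C]_Q :=
  (Hmx sl) ^t* *m invmx Rc *m Hmx s + (Hmx s) ^t* *m invmx Rc *m Hmx sl
  - (Hmx sl) ^t* *m invmx Rc *m Hmx sl.

Lemma Umx_hermsymmx (Rc : 'M[C]_((Q + L - 1) * NR)) (s sl : 'cV[C]_(L * NT)) :
  Rc \is hermsymmx -> Umx Rc s sl \is hermsymmx.
Proof.
move=> /hermsymmx_inv hR; apply/is_hermitianmxP; rewrite expr0 scale1r /Umx.
rewrite !linearB !linearD /= !map_mxB !map_mxD.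
by rewrite !(hermsymmx_congr _ _ hR) [X in _ = X - _]addrC.
Qed.

End Waveform.

Definition cis (x : R) : C := cos x +i* sin x.

Definition bandmx (L : nat) (f1 f2 : R) : 'M[C]_L :=
  \matrix_(m, n)
    if m == n then (f2 - f1)%:C
    else (cis (2 * pi * f2 * (m%:R - n%:R)) - cis (2 * pi * f1 * (m%:R - n%:R)))
         / (0 +i* (2 * pi * (m%:R - n%:R))).

(* The factors of the Kronecker product are ordered I_{NT}, R_I^k, so that its
   size is NT * L; the cast only renames this size to L * NT, that of the
   waveform, and leaves all entries in place. *)
Definition RImx (NT L K : nat) (alpha f1 f2 : 'I_K -> R) : 'M[C]_(L * NT) :=
  \sum_(k < K) (alpha k)%:C *:
    castmx (mulnC NT L, mulnC NT L)
           (mxtens.tensmx (1%:M : 'M[C]_NT) (bandmx L (f1 k) (f2 k))).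

Definition PsiS (NT L : nat) (RI : 'M[C]_(L * NT)) (et delta eI : R)
    (s0 : 'cV[C]_(L * NT)) : set 'cV[C]_(L * NT) :=
  [set s | [/\ l2norm s ^+ 2 <= et,
               linfnorm (s - s0) <= delta * Num.sqrt et / Num.sqrt (NT * L)%:R
             & (s ^t* *m RI *m s) ord0 ord0 <= eI%:C]].

Definition ztilde (Q : nat) (U : 'M[C]_Q) (t0 : 'cV[C]_Q) (r : R) : R :=
  setmin [set qform U t | t in [set t | l2norm (t - t0) <= r]].

(* The minimum over the ball is attained, for every r >= 0. *)
Section Attained.
Variable Q : nat.

Let tvec (x : 'rV[R]_(Q + Q)) : 'cV[C]_Q :=
  \col_i (x ord0 (lshift Q i) +i* x ord0 (rshift Q i)).

Let tvecK (t : 'cV[C]_Q) : exists x, tvec x = t.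
Proof.
exists (row_mx (\row_i complex.Re (t i ord0)) (\row_i complex.Im (t i ord0))).
apply/matrixP => i j; rewrite (ord1 j) mxE.
by rewrite row_mxEl row_mxEr !mxE; case: (t i ord0).
Qed.

Let coord_cont (k : 'I_(Q + Q)) :
  continuous (fun x : 'rV[R]_(Q + Q) => x ord0 k).
Proof. exact: coord_continuous. Qed.

Let cD (f g : 'rV[R]_(Q + Q) -> R) : continuous f -> continuous g ->
  continuous (fun x => f x + g x).
Proof. by move=> cf cg x; exact: (cvgD (cf x) (cg x)). Qed.

Let cM (f g : 'rV[R]_(Q + Q) -> R) : continuous f -> continuous g ->
  continuous (fun x => f x * g x).
Proof. by move=> cf cg x; exact: (cvgM (cf x) (cg x)). Qed.

Let cS (I : finType) (f : I -> 'rV[R]_(Q + Q) -> R) :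
  (forall i, continuous (f i)) -> continuous (fun x => \sum_i f i x).
Proof.
move=> cf; elim: (index_enum I) => [|i s IH].
  under eq_fun do rewrite big_nil; exact: cst_continuous.
by under eq_fun do rewrite big_cons; exact: cD.
Qed.

Let qform_cont (U : 'M[C]_Q) : continuous (fun x => qform U (tvec x)).
Proof.
pose re i (x : 'rV[R]_(Q + Q)) := x ord0 (lshift Q i).
pose im i (x : 'rV[R]_(Q + Q)) := x ord0 (rshift Q i).
have -> : (fun x => qform U (tvec x)) = fun x => \sum_j \sum_i
   ((complex.Re (U i j)) * (re i x * re j x + im i x * im j x)
    + complex.Im (U i j) * (im i x * re j x + (-1) * (re i x * im j x))).
  apply/funext => x; rewrite /qform mxE.
  rewrite (big_morph (@complex.Re R) (id1 := 0) (op1 := +%R))//; last first.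
    by move=> [? ?] [? ?].
  apply: eq_bigr => j _; rewrite mxE mulr_suml.
  rewrite (big_morph (@complex.Re R) (id1 := 0) (op1 := +%R))//; last first.
    by move=> [? ?] [? ?].
  apply: eq_bigr => i _; rewrite !mxE /re /im.
  by case: (U i j) => u v /=; ring.
have cst c : continuous (fun _ : 'rV[R]_(Q + Q) => c : R).
  exact: cst_continuous.
apply: cS => j; apply: cS => i; rewrite /re /im.
by repeat (exact: coord_cont || exact: cst || apply: cD || apply: cM).
Qed.

Let sumsq (t0 : 'cV[C]_Q) x : \sum_(i < Q)
  ComplexField.Normc.normc ((tvec x - t0) i ord0) ^+ 2 =
  \sum_(i < Q) ((x ord0 (lshift Q i) - complex.Re (t0 i ord0)) ^+ 2
               + (x ord0 (rshift Q i) - complex.Im (t0 i ord0)) ^+ 2).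
Proof.
apply: eq_bigr => i _; rewrite !mxE; case: (t0 i ord0) => u v /=.
by rewrite sqr_sqrtr// addr_ge0// sqr_ge0.
Qed.

Let ball_closed (t0 : 'cV[C]_Q) r :
  closed [set x | l2norm (tvec x - t0) <= r].
Proof.
have cst c : continuous (fun _ : 'rV[R]_(Q + Q) => c : R).
  exact: cst_continuous.
pose g (x : 'rV[R]_(Q + Q)) := \sum_(i < Q)
  ((x ord0 (lshift Q i) + - complex.Re (t0 i ord0))
   * (x ord0 (lshift Q i) + - complex.Re (t0 i ord0))
   + (x ord0 (rshift Q i) + - complex.Im (t0 i ord0))
   * (x ord0 (rshift Q i) + - complex.Im (t0 i ord0))).
have gc : continuous g.
  apply: cS => i.
  by repeat (exact: coord_cont || exact: cst || apply: cD || apply: cM).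
have -> : [set x | l2norm (tvec x - t0) <= r] = [set x | Num.sqrt (g x) <= r].
  by apply/funext => x /=; rewrite /l2norm sumsq.
apply: (@closed_comp _ _ (fun x => Num.sqrt (g x)) [set y | y <= r]).
  by move=> x _; apply: continuous_comp; [exact: gc|exact: sqrt_continuous].
exact: closed_le.
Qed.

Let ball_compact (t0 : 'cV[C]_Q) r : 0 <= r ->
  compact [set x | l2norm (tvec x - t0) <= r].
Proof.
move=> r0; have [c cE] := tvecK t0.
have cpt := rV_compact
  (fun k : 'I_(Q + Q) => @segment_compact R (c ord0 k - r) (c ord0 k + r)).
apply: (subclosed_compact _ cpt); first exact: ball_closed.
move=> x /= xr k; rewrite in_itv/= -ler_distl.
have : (x ord0 k - c ord0 k) ^+ 2 <= r ^+ 2.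
  have : l2norm (tvec x - t0) ^+ 2 <= r ^+ 2 by rewrite lerXn2r// nnegrE ?sqrtr_ge0.
  have pos i : 0 <= (x ord0 (lshift Q i) - complex.Re (t0 i ord0)) ^+ 2
    + (x ord0 (rshift Q i) - complex.Im (t0 i ord0)) ^+ 2.
    by rewrite addr_ge0 ?sqr_ge0.
  rewrite /l2norm sumsq sqr_sqrtr ?sumr_ge0//; apply: le_trans.
  case: (split_ordP k) => i ->; rewrite (bigD1 i)//= -cE !mxE /=;
  [rewrite -addrA lerDl | rewrite addrAC lerDr];
  by rewrite addr_ge0 ?sqr_ge0// sumr_ge0// => l _; rewrite addr_ge0 ?sqr_ge0.
by rewrite -ler_sqrt ?sqr_ge0// !sqrtr_sqr (ger0_norm r0).
Qed.

Lemma ztilde_attained (U : 'M[C]_Q) (t0 : 'cV[C]_Q) (r : R) : 0 <= r ->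
  exists2 t, l2norm (t - t0) <= r & ztilde U t0 r = qform U t /\
    forall t', l2norm (t' - t0) <= r -> qform U t <= qform U t'.
Proof.
move=> r0; have [c cE] := tvecK t0.
have ne : [set x | l2norm (tvec x - t0) <= r] !=set0.
  exists c => /=; rewrite cE subrr /l2norm big1 ?sqrtr0// => i _.
  by rewrite mxE ComplexField.Normc.normc0 expr0n.
have [x /set_mem /= xr xmin] := compact_EVT_min ne (@ball_compact t0 r r0)
  (continuous_subspaceT (@qform_cont U)).
have tmin t' : l2norm (t' - t0) <= r -> qform U (tvec x) <= qform U t'.
  by have [y <-] := tvecK t' => yr; apply: xmin; apply/mem_set.
exists (tvec x) => //; split => //; rewrite /ztilde /setmin.
case: xgetP => [v -> [[t tr <-] tl]|/(_ (qform U (tvec x)))].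
  by apply/eqP; rewrite eq_le tmin// andbT; apply: tl; exists (tvec x).
case; split; first by exists (tvec x).
by move=> _ [t tr <-]; exact: tmin.
Qed.

End Attained.

Definition LMImx (Q : nat) (U : 'M[C]_Q) (t0 : 'cV[C]_Q) (r lambda gamma : R)
    : 'M[C]_(Q + 1) :=
  block_mx (U + (lambda%:C)%:M) (lambda%:C *: t0)
           (lambda%:C *: t0 ^t*)
           (lambda%:C *: (t0 ^t* *m t0) - ((lambda * r ^+ 2 + gamma)%:C)%:M).

End Radar.

(* Main.v *)
(* Fix U Hermitian and let t minimise t^H U t over the ball. The first- and
   second-order conditions give lambda >= 0, zero off the sphere, such that
   (U + lambda I) t = lambda t0 and U + lambda I is positive semidefinite
   (the S-lemma for a ball). For gamma = t^H U t this says that the LMI matrix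
   kills (t, -1), so its form at (u, y) is that of U + lambda I at u + y t.
   Conversely, the form of the LMI matrix at (t, -1) is
   t^H U t + lambda (||t - t0||^2 - r^2) - gamma, so that feasible gamma are
   lower bounds on the ball. *)
From HB Require Import structures.
Require Import Defs.
From mathcomp Require Import all_boot all_order all_algebra.
From mathcomp Require Import all_classical all_reals all_analysis.
From mathcomp Require Import complex.
From mathcomp Require Import ring lra.
Import Order.TTheory GRing.Theory Num.Theory.
Local Open Scope classical_set_scope.
Local Open Scope ring_scope.
Local Open Scope sesquilinear_scope.
Local Open Scope complex_scope.

Set Implicit Arguments.
Unset Strict Implicit.
Unset Printing Implicit Defensive.

(** This replaces the passage to the limit as [e] tends to 0 from above. If [a] were negative, a
    step with [e * m <= - a / 2], where [m] dominates the coefficients, would leave the sum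
    negative. *)
Lemma quadratic_small_ge0 (R : realFieldType) (a b c e0 : R) : 0 < e0 ->
  (forall e, 0 < e <= e0 -> 0 <= a + e * b + e ^+ 2 * c) -> 0 <= a.
Proof.
move=> e0gt0 h; rewrite leNgt; apply/negP => alt0.
pose m := `|b| + e0 * `|c| + 1.
have m1 : 1 <= m by rewrite lerDr addr_ge0// mulr_ge0// ltW.
pose e := Num.min e0 (- a / (2 * m)).
have e_gt0 : 0 < e by rewrite lt_min e0gt0 divr_gt0//; lra.
have ele : e <= e0 by rewrite ge_min lexx.
have em : e * m <= - a / 2.
  rewrite -ler_pdivlMr; last by lra.
  by rewrite -mulrA -invfM ge_min lexx orbT.
have := h e; rewrite e_gt0 ele => /(_ isT).
have hb : e * b <= e * `|b| by rewrite ler_wpM2l ?ler_norm// ltW.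
have hc : e ^+ 2 * c <= e * (e0 * `|c|).
  rewrite expr2 -mulrA ler_wpM2l ?(ltW e_gt0)//.
  apply: (le_trans (y := e * `|c|)).
    by rewrite ler_wpM2l ?ler_norm// ltW.
  by rewrite ler_wpM2r.
by move: em; rewrite /m !mulrDr mulr1; lra.
Qed.

(* Locked, because [ring] and [lra] would unfold it when comparing atoms. *)
HB.lock Definition rdot (R : realType) (n : nat) (x y : 'cV[R[i]]_n) : R :=
  complex.Re ((x ^t* *m y) ord0 ord0).
Arguments rdot {R n}.

(** * The real inner product Re(x^H y) on complex vectors *)

Section RealDot.
Variables (R : realType) (n : nat).
Implicit Types (x y z : 'cV[R[i]]_n) (c : R).

Lemma rdotE x y : rdot x y = \sum_i
  (complex.Re (x i ord0) * complex.Re (y i ord0)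
   + complex.Im (x i ord0) * complex.Im (y i ord0)).
Proof.
rewrite rdot.unlock mxE raddf_sum; apply: eq_bigr => i _; rewrite !mxE.
by case: (x i ord0) (y i ord0) => [? ?] [? ?] /=; ring.
Qed.

Lemma rdotC x y : rdot x y = rdot y x.
Proof. by rewrite !rdotE; apply: eq_bigr => i _; ring. Qed.

Lemma rdotDr x y z : rdot x (y + z) = rdot x y + rdot x z.
Proof. by rewrite rdot.unlock mulmxDr mxE raddfD. Qed.

Lemma rdotDl x y z : rdot (x + y) z = rdot x z + rdot y z.
Proof. by rewrite ![rdot _ z]rdotC rdotDr. Qed.

Lemma rdotZr c x y : rdot x (c%:C *: y) = c * rdot x y.
Proof.
rewrite rdot.unlock -scalemxAr mxE.
by case: ((x ^t* *m y) ord0 ord0) => ? ? /=; ring.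
Qed.

Lemma rdotZl c x y : rdot (c%:C *: x) y = c * rdot x y.
Proof. by rewrite ![rdot _ y]rdotC rdotZr. Qed.

Lemma rdotNr x y : rdot x (- y) = - rdot x y.
Proof. by rewrite rdot.unlock mulmxN mxE raddfN. Qed.

Lemma rdotNl x y : rdot (- x) y = - rdot x y.
Proof. by rewrite ![rdot _ y]rdotC rdotNr. Qed.

Lemma rdot_ge0 x : 0 <= rdot x x.
Proof.
by rewrite rdotE sumr_ge0// => i _; rewrite -!expr2 addr_ge0// sqr_ge0.
Qed.

Lemma rdot_eq0 x : (rdot x x == 0) = (x == 0).
Proof.
apply/eqP/eqP => [|->]; last by rewrite rdot.unlock mulmx0 mxE.
rewrite rdotE => /psumr_eq0P h; apply/matrixP => i j; rewrite (ord1 j) mxE.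
have /eqP := h (fun i _ => addr_ge0 (sqr_ge0 _) (sqr_ge0 _)) i isT.
rewrite -!expr2 paddr_eq0 ?sqr_ge0// !sqrf_eq0.
by case: (x i ord0) => u v /= /andP[/eqP-> /eqP->].
Qed.

Lemma l2norm_sqr x : l2norm x ^+ 2 = rdot x x.
Proof.
rewrite sqr_sqrtr ?sumr_ge0 ?rdotE// => [|i _]; last exact: sqr_ge0.
apply: eq_bigr => i _; case: (x i ord0) => u v /=.
by rewrite sqr_sqrtr// addr_ge0// sqr_ge0.
Qed.

Lemma l2norm_le x r : 0 <= r -> (l2norm x <= r) = (rdot x x <= r ^+ 2).
Proof. by move=> r0; rewrite -l2norm_sqr ler_sqr// nnegrE// sqrtr_ge0. Qed.

Lemma qform_rdot (A : 'M[R[i]]_n) x : qform A x = rdot x (A *m x).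
Proof. by rewrite /qform rdot.unlock mulmxA. Qed.

Lemma rdot_hermsymmx (A : 'M[R[i]]_n) x y : A \is hermsymmx ->
  rdot x (A *m y) = rdot y (A *m x).
Proof.
move=> hA; rewrite rdot.unlock !mulmxA -(hermsymmx_congr x y hA) !mxE.
by rewrite -[RHS]/(complex.Re _); case: (\sum_j _) => ? ?.
Qed.

Lemma trC_mulmx x : x ^t* *m x = ((rdot x x)%:C)%:M.
Proof.
have h1 : (1%:M : 'M[R[i]]_n) \is hermsymmx.
  apply/is_hermitianmxP; rewrite expr0 scale1r tr_scalar_mx map_scalar_mx.
  by congr (_%:M); exact/esym/conjc1.
rewrite [LHS]mx11_scalar -[x ^t*]mulmx1 qform_real//.
by rewrite qform_rdot mul1mx.
Qed.

Lemma rdot_col_mx m (x1 y1 : 'cV[R[i]]_n) (x2 y2 : 'cV[R[i]]_m) :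
  rdot (col_mx x1 x2) (col_mx y1 y2) = rdot x1 y1 + rdot x2 y2.
Proof.
by rewrite rdot.unlock tr_col_mx map_row_mx mul_row_col mxE raddfD.
Qed.

End RealDot.

(** * Optimality conditions for a quadratic form on a ball *)

Section TrustRegion.
Variables (R : realType) (n : nat) (U : 'M[R[i]]_n) (t0 t d : 'cV[R[i]]_n).
Variable r : R.
(* Naming t - t0 keeps the additivity lemmas of rdot from splitting it. *)
Hypothesis dE : d = t - t0.
Hypothesis hU : U \is hermsymmx.
Hypothesis r_gt0 : 0 < r.
Hypothesis t_ball : l2norm (t - t0) <= r.
Hypothesis t_min : forall u, l2norm (u - t0) <= r -> qform U t <= qform U u.

Lemma qform_line v e : qform U (t + e%:C *: v) =
  qform U t + e * (2 * rdot v (U *m t)) + e ^+ 2 * rdot v (U *m v).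
Proof.
rewrite !qform_rdot mulmxDr -scalemxAr !(rdotDl, rdotDr, rdotZl, rdotZr).
by rewrite (rdot_hermsymmx t v hU); ring.
Qed.

Lemma ball_line v e : (l2norm (t + e%:C *: v - t0) <= r) =
  (rdot d d + e * (2 * rdot d v) + e ^+ 2 * rdot v v <= r ^+ 2).
Proof.
rewrite (l2norm_le _ (ltW r_gt0)) addrAC -dE.
rewrite !(rdotDl, rdotDr, rdotZl, rdotZr) (rdotC v d).
by congr (_ <= _); ring.
Qed.

Lemma sqr_ball : rdot d d <= r ^+ 2.
Proof. by rewrite dE -(l2norm_le _ (ltW r_gt0)). Qed.

(** Either [t] is interior, or [v] points strictly into the ball; in both cases short steps along
    [v] cannot leave it. *)
Lemma feasible_step v : rdot d d < r ^+ 2 \/ rdot d v < 0 ->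
  exists2 e0, 0 < e0 & forall e, 0 < e <= e0 ->
    l2norm (t + e%:C *: v - t0) <= r.
Proof.
have c_ge0 := rdot_ge0 v; set k := 2 * rdot d v.
case=> [slack|slope]; last first.
  (* Up to this length [k + e * rdot v v <= 0], so the distance to [t0] does not grow. *)
  exists (- k / (rdot v v + 1)) => [|e /andP[e_gt0 ele]].
    by rewrite divr_gt0 /k; lra.
  rewrite ball_line -/k; apply: le_trans sqr_ball.
  rewrite -addrA gerDl expr2 -mulrA -mulrDr pmulr_rle0//.
  by move: ele; rewrite ler_pdivlMr; lra.
(* For [e <= 1] the squared distance grows by at most [e * m], which the second bound on [e] keeps
   within the slack. *)
pose m := `|k| + rdot v v + 1.
have m_gt0 : 0 < m by rewrite ltr_wpDl// addr_ge0.
exists (Num.min 1 ((r ^+ 2 - rdot d d) / m)) => [|e].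
  by rewrite lt_min ltr01 divr_gt0// subr_gt0.
rewrite le_min => /andP[e_gt0 /andP[e1 em]]; rewrite ball_line -/k.
have hk : e * k <= e * `|k| by rewrite ler_wpM2l ?ler_norm// ltW.
have hc : e ^+ 2 * rdot v v <= e * rdot v v.
  by rewrite ler_wpM2r// expr2 ger_pMr.
by move: em; rewrite ler_pdivlMr// /m !mulrDr mulr1; lra.
Qed.

(** Along [v] the form has slope [2 * rdot v (U *m t)] at [t], and a minimum has no descending
    feasible direction. *)
Lemma first_order v : rdot d d < r ^+ 2 \/ rdot d v < 0 ->
  0 <= rdot v (U *m t).
Proof.
move=> /feasible_step[e0 e0_gt0 he].
suff : 0 <= 2 * rdot v (U *m t) by rewrite pmulr_rge0.
apply: (quadratic_small_ge0 (b := rdot v (U *m v)) (c := 0) e0_gt0) => e ee.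
have := t_min (he _ ee); rewrite qform_line -addrA lerDl.
case/andP: ee => e_gt0 _.
have -> : e * (2 * rdot v (U *m t)) + e ^+ 2 * rdot v (U *m v) =
  e * (2 * rdot v (U *m t) + e * rdot v (U *m v) + e ^+ 2 * 0) by ring.
by rewrite pmulr_rge0.
Qed.

(** [U] may be indefinite, so the last condition does not come from convexity. It holds for all [v],
    not only for tangent ones, because almost every line through a point of the sphere meets the
    sphere again, and minimality applies there. *)
Lemma trust_region_kkt : exists lambda : R,
  [/\ 0 <= lambda, lambda * (rdot d d - r ^+ 2) = 0,
      U *m t = - (lambda%:C *: d)
    & forall v, 0 <= rdot v (U *m v) + lambda * rdot v v].
Proof.
move: sqr_ball; rewrite le_eqVlt => /orP[/eqP dr|dr]; last first.
  (* Interior minimum: every direction is feasible, so the gradient vanishes and only the quadratic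
     term of the increment is left. *)
  exists 0; split => // [||v].
  - by rewrite mul0r.
  - have := first_order (v := - (U *m t)) (or_introl dr).
    rewrite rdotNl oppr_ge0 => h; rewrite scale0r oppr0; apply/eqP.
    by rewrite -rdot_eq0 eq_le h rdot_ge0.
  - rewrite mul0r addr0.
    have dr' w : rdot d d < r ^+ 2 \/ rdot d w < 0 by left.
    have [e0 e0_gt0 he] := feasible_step (dr' v).
    have ee : 0 < e0 <= e0 by rewrite e0_gt0 lexx.
    have := t_min (he _ ee); rewrite qform_line -addrA lerDl.
    have -> : rdot v (U *m t) = 0.
      have := first_order (dr' v); have := first_order (dr' (- v)).
      by rewrite rdotNl; lra.
    by rewrite mulr0 mulr0 add0r pmulr_rge0// exprn_gt0.
have r2_gt0 : 0 < r ^+ 2 by rewrite exprn_gt0.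
(* This value is forced by pairing [g = - (lambda%:C *: d)] with [d], as [rdot d d = r ^+ 2]. *)
pose g := U *m t; pose lambda := - rdot d g / r ^+ 2.
have lambdaE : lambda * r ^+ 2 = - rdot d g by rewrite divfK// gt_eqF.
have lambda_ge0 : 0 <= lambda.
  apply: divr_ge0; last exact: ltW.
  rewrite -rdotNl; apply: first_order; right.
  by rewrite rdotNr dr oppr_lt0.
have gE : g = - (lambda%:C *: d).
  (* [w] is the part of [g] orthogonal to [d]. The direction [- w] is only tangent, so it is tilted
     inward by [- e d]; letting [e] vanish gives [rdot w g <= 0], and [rdot w g] equals
     [rdot w w]. *)
  pose w := g + lambda%:C *: d.
  have wd : rdot w d = 0.
    by rewrite rdotDl rdotZl dr lambdaE (rdotC g) subrr.
  have wg : 0 <= - rdot w g.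
    apply: (quadratic_small_ge0 (b := - rdot d g) (c := 0) ltr01).
    move=> e /andP[e_gt0 _].
    have := first_order (v := - w - e%:C *: d); rewrite -/g.
    rewrite rdotDr !rdotNr rdotZr (rdotC d w) wd dr oppr0 sub0r oppr_lt0.
    rewrite rdotDl !rdotNl rdotZl mulr_gt0// => /(_ (or_intror isT)).
    by rewrite mulr0 addr0 mulrN.
  apply/eqP; rewrite -addr_eq0 -/w -rdot_eq0 eq_le rdot_ge0 andbT.
  by rewrite {2}/w rdotDr rdotZr wd mulr0 addr0 -oppr_ge0.
exists lambda; split => //; first by rewrite dr subrr mulr0.
have gdot v : rdot v g = - (lambda * rdot d v).
  by rewrite gE rdotNr rdotZr (rdotC v).
have psd_transverse v : rdot d v != 0 ->
    0 <= rdot v (U *m v) + lambda * rdot v v.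
  move=> dv; have v_neq0 : rdot v v != 0.
    rewrite rdot_eq0; apply: contra dv => /eqP->.
    by rewrite rdot.unlock mulmx0 mxE.
  (* The reflected point [t + c v] is the other end of a chord of the sphere. *)
  pose c := - (2 * rdot d v) / rdot v v.
  have cE : c * rdot v v = - (2 * rdot d v) by rewrite divfK.
  have c_neq0 : c != 0.
    by rewrite mulf_neq0 ?invr_eq0// oppr_eq0 mulf_neq0// pnatr_eq0.
  have : l2norm (t + c%:C *: v - t0) <= r.
    rewrite ball_line dr (_ : r ^+ 2 + _ + _ =
      r ^+ 2 + c * (2 * rdot d v + c * rdot v v)); last by ring.
    by rewrite cE subrr mulr0 addr0.
  (* By the choice of [c], the increment of the form along the chord is [c ^+ 2] times the shifted
     form at [v]. *)
  move=> /t_min; rewrite qform_line -/g gdot -addrA lerDl.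
  rewrite (_ : _ + _ = c * (lambda * - (2 * rdot d v)) +
    c ^+ 2 * rdot v (U *m v)); last by ring.
  rewrite -cE (_ : _ + _ = c ^+ 2 * (rdot v (U *m v) + lambda * rdot v v)).
    by rewrite pmulr_rge0// exprn_even_gt0.
  by ring.
move=> v; have [dv|] := eqVneq (rdot d v) 0; last exact: psd_transverse.
(* A tangent [v] is a limit of the transverse directions [v + e d], since
   [rdot d (v + e d) = e * r ^+ 2]. *)
apply: (quadratic_small_ge0 (b := 2 * rdot d (U *m v) + lambda * (2 * rdot d v))
  (c := rdot d (U *m d) + lambda * rdot d d) ltr01) => e /andP[e_gt0 _].
have := psd_transverse (v + e%:C *: d); rewrite rdotDr rdotZr dv dr add0r.
rewrite mulf_neq0 ?gt_eqF// => /(_ isT).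
rewrite mulmxDr -scalemxAr !(rdotDl, rdotDr, rdotZl, rdotZr).
rewrite (rdot_hermsymmx v d hU) (rdotC v d) dv -dr; congr (_ <= _); ring.
Qed.

End TrustRegion.

(** * The LMI matrix and its vectors [col_mx t (- 1%:M)] *)

Section LMI.
Variables (R : realType) (n : nat) (U : 'M[R[i]]_n) (t0 : 'cV[R[i]]_n).
Variables (r lambda : R).
Hypothesis hU : U \is hermsymmx.
Implicit Types (t : 'cV[R[i]]_n) (gamma : R).

Lemma LMImx_hermsymmx gamma : LMImx U t0 r lambda gamma \is hermsymmx.
Proof.
move/is_hermitianmxP: hU; rewrite expr0 scale1r => hU'.
apply/is_hermitianmxP; rewrite expr0 scale1r /LMImx tr_block_mx map_block_mx.
congr block_mx.
- rewrite linearD /= map_mxD -hU' tr_scalar_mx map_scalar_mx /=.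
  by congr (_ + _%:M); exact/esym/conjc_real.
- apply/matrixP => i j; rewrite !mxE rmorphM /= conjCK.
  by congr (_ * _); exact/esym/conjc_real.
- apply/matrixP => i j; rewrite !mxE rmorphM /=.
  by congr (_ * _); exact/esym/conjc_real.
- rewrite linearB /= map_mxB tr_scalar_mx map_scalar_mx.
  rewrite linearZ /= map_mxZ /= trmx_mul map_mxM.
  congr (_ + - _%:M); last exact/esym/conjc_real.
  congr (_ *: _); first exact/esym/conjc_real.
  congr (_ *m _); apply/matrixP => i j; rewrite !mxE; exact/esym/conjCK.
Qed.

Lemma LMImx_mul gamma t :
  LMImx U t0 r lambda gamma *m col_mx t (- 1%:M) =
  col_mx (U *m t + lambda%:C *: (t - t0))
         (lambda%:C *: (t0 ^t* *m (t - t0))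
          + ((lambda * r ^+ 2 + gamma)%:C)%:M).
Proof.
rewrite mul_block_col !mulmxN !mulmx1 mulmxDl mul_scalar_mx -scalemxAl.
rewrite scalerBr mulmxBr scalerBr addrA opprB addrA -!addrA.
by rewrite [X in col_mx _ (_ + X)]addrC.
Qed.

Lemma LMImx_lower_bound gamma t : 0 <= lambda ->
  psdmx (LMImx U t0 r lambda gamma) -> l2norm (t - t0) <= r ->
  gamma <= qform U t.
Proof.
move=> lambda_ge0 [hA psdA] t_ball.
have d2 : rdot (t - t0) (t - t0) <= r ^+ 2.
  by rewrite -l2norm_le// (le_trans _ t_ball)// sqrtr_ge0.
have := psdA (col_mx t (- 1%:M)).
rewrite qform_real// lecR qform_rdot LMImx_mul rdot_col_mx.
have -> : rdot (- 1%:M) (lambda%:C *: (t0 ^t* *m (t - t0))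
      + ((lambda * r ^+ 2 + gamma)%:C)%:M) =
    - (lambda * rdot t0 (t - t0) + (lambda * r ^+ 2 + gamma)).
  rewrite rdotNl (rdotDr 1%:M) rdotZr; congr (- (_ * _ + _)).
    rewrite rdot.unlock tr_scalar_mx map_scalar_mx.
    by rewrite mul_scalar_mx rmorph1 scale1r.
  rewrite rdot.unlock tr_scalar_mx map_scalar_mx rmorph1 mul1mx.
  by rewrite mxE eqxx.
rewrite (rdotDr t (U *m t)) rdotZr -qform_rdot => h.
have : rdot (t - t0) (t - t0) = rdot t (t - t0) - rdot t0 (t - t0).
  by rewrite [LHS]rdotDl rdotNl.
move: h d2; set p := rdot t (t - t0); set q := rdot t0 (t - t0).
move: p q (rdot _ _) => p q w h d2 wE.
(* Inside the ball the penalty [lambda * (w - r ^+ 2)] is nonpositive, so dropping it preserves the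
   bound on [gamma]. *)
have : lambda * w <= lambda * r ^+ 2 by rewrite ler_wpM2l.
by move: h; rewrite wE mulrBr; lra.
Qed.

Hypothesis shift_psd : forall v : 'cV[R[i]]_n,
  0 <= rdot v (U *m v) + lambda * rdot v v.

Lemma LMImx_psd t : U *m t = - (lambda%:C *: (t - t0)) ->
  lambda * (rdot (t - t0) (t - t0) - r ^+ 2) = 0 ->
  psdmx (LMImx U t0 r lambda (qform U t)).
Proof.
move=> stationary slack; set A := LMImx _ _ _ _ _.
have hA : A \is hermsymmx by exact: LMImx_hermsymmx.
have Ak0 : A *m col_mx t (- 1%:M) = 0.
  rewrite LMImx_mul stationary addNr -[RHS]vsubmxK !linear0; congr col_mx.
  (* Complementary slackness trades [r ^+ 2] for the squared norm of [t - t0], on the sphere or when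
     [lambda] is 0. *)
  have -> : ((lambda * r ^+ 2 + qform U t)%:C)%:M =
      lambda%:C *: ((t - t0) ^t* *m (t - t0)) + t ^t* *m (U *m t) :> 'M[R[i]]_1.
    rewrite trC_mulmx [X in _ = _ + X]mx11_scalar mulmxA qform_real//.
    rewrite scale_scalar_mx -raddfD /=; congr (_%:M).
    move: slack; rewrite mulrBr => /eqP; rewrite subr_eq0 => /eqP <-.
    by rewrite rmorphD rmorphM.
  (* With [U *m t] eliminated, all terms share the right factor [t - t0], and their left factors
     cancel. *)
  rewrite stationary mulmxN -scalemxAr -scalerBr -scalerDr -mulmxBl -mulmxDl.
  have -> : t0 ^t* + ((t - t0) ^t* - t ^t*) = 0.
    by apply/matrixP => i j; rewrite !mxE rmorphB /= addrAC subrr sub0r subrr.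
  by rewrite mul0mx scaler0.
split=> // x; rewrite qform_real// lecR qform_rdot.
rewrite -[x]vsubmxK [X in col_mx _ X]mx11_scalar.
set u := usubmx x; set y := dsubmx x ord0 ord0.
(* The second summand lies in the kernel. It drops out on the right directly and on the left by
   Hermitian symmetry, leaving the upper left block at [u + y *: t]. *)
have -> : col_mx u y%:M = col_mx (u + y *: t) 0 + (- y) *: col_mx t (- 1%:M).
  rewrite scale_col_mx add_col_mx scalerN scaleNr scaleNr addrK opprK add0r.
  by rewrite scale_scalar_mx mulr1.
set w := u + _; rewrite mulmxDr -scalemxAr Ak0 scaler0 addr0.
rewrite (rdot_hermsymmx _ _ hA) mulmxDr -scalemxAr Ak0 scaler0 addr0.
rewrite mul_block_col !mulmx0 !addr0 rdot_col_mx.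
have -> z : rdot (0 : 'cV[R[i]]_1) z = 0.
  by rewrite rdotC rdot.unlock mulmx0 mxE.
by rewrite addr0 mulmxDl rdotDr mul_scalar_mx rdotZr.
Qed.

End LMI.

(** * Equivalence of the two problems *)

(** For a fixed waveform this eliminates the auxiliary variables: the largest feasible [gamma]
    exists and is the inner minimum, so strong duality holds with both optima attained. *)
Lemma ztilde_LMImx (R : realType) (n : nat) (U : 'M[R[i]]_n)
    (t0 : 'cV[R[i]]_n) (r : R) : U \is hermsymmx -> 0 < r ->
  (exists2 lambda, 0 <= lambda & psdmx (LMImx U t0 r lambda (ztilde U t0 r))) /\
  (forall lambda gamma, 0 <= lambda -> psdmx (LMImx U t0 r lambda gamma) ->
    gamma <= ztilde U t0 r).
Proof.
move=> hU r_gt0; have [t t_ball [-> t_min]] := ztilde_attained U t0 (ltW r_gt0).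
split=> [|lambda gamma lambda_ge0 psdA]; last exact: LMImx_lower_bound psdA _.
have [lambda [lambda_ge0 slack stationary shift_psd]] :=
  trust_region_kkt erefl hU r_gt0 t_ball t_min.
by exists lambda => //; exact: LMImx_psd.
Qed.

Theorem proposition3 (R : realType)
  (NT NR L Q : nat)
  (hNT : (1 <= NT)%N) (hNR : (1 <= NR)%N) (hL : (1 <= L)%N) (hQ : (1 <= Q)%N)
  (a : 'cV[R[i]]_NT) (b : 'cV[R[i]]_NR)
  (Rc : 'M[R[i]]_((Q + L - 1) * NR)) (hRc : posdefmx Rc)
  (K : nat) (alpha f1 f2 : 'I_K -> R)
  (halpha : forall k, 0 <= alpha k) (hf : forall k, f1 k < f2 k)
  (et r delta eI : R)
  (het : 0 < et) (hr : 0 < r) (hdelta : 0 < delta <= 2) (heI : 0 <= eI)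
  (t0 : 'cV[R[i]]_Q) (s0 : 'cV[R[i]]_(L * NT)) :
  let Psi := PsiS (RImx NT L alpha f1 f2) et delta eI s0 in
  Psi !=set0 ->
  forall sl : 'cV[R[i]]_(L * NT), Psi sl ->
  let U (s : 'cV[R[i]]_(L * NT)) := Umx a b Rc s sl in
  forall s : 'cV[R[i]]_(L * NT),
    is_argmax Psi (fun s' => ztilde (U s') t0 r) s
    <->
    exists lambda gamma : R,
      is_argmax
        [set p : 'cV[R[i]]_(L * NT) * R * R |
          [/\ psdmx (LMImx (U p.1.1) t0 r p.1.2 p.2), Psi p.1.1 & 0 <= p.1.2]]
        (fun p => p.2)
        (s, lambda, gamma).
Proof.
move=> Psi Psi_neq0 sl _ U s.
have lmi s' := ztilde_LMImx t0 (Umx_hermsymmx a b s' sl hRc.1) hr.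
split=> [[Psi_s smax]|[lambda [gamma [[/= psd Psi_s lambda_ge0] pmax]]]].
  have [[lambda lambda_ge0 psd] _] := lmi s.
  exists lambda, (ztilde (U s) t0 r); split=> //= -[[s' lambda'] gamma'] /=.
  move=> [psd' Psi_s' lambda'_ge0]; apply: le_trans (smax _ Psi_s').
  exact: (lmi s').2 psd'.
split; first exact: Psi_s.
(* Each competitor [s'] lifts to a feasible triple whose value is its own inner minimum. Optimality
   bounds this by [gamma], which is at most the inner minimum at [s]. *)
move=> s' Psi_s'; have [[lambda' lambda'_ge0 psd'] _] := lmi s'.
apply: le_trans ((lmi s).2 _ _ lambda_ge0 psd).
exact: (pmax (s', lambda', ztilde (U s') t0 r)).
Qed.
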